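(* Let $n,m\ge1$ be integers, let $\Delta_1,\dots,\Delta_m\subseteq[n]$ be cliques covering $[n]$, none contained in another, let $f_i:\mathbb R^{|\Delta_i|}\to\mathbb R$ be polynomials and $\mathbf g_i:\mathbb R^{|\Delta_i|}\to\mathbb R^{N_i}$ ($N_i\in\mathbb N$) be vectors of polynomials for $i\in[m]$. Set $f(\mathbf x)=\sum_{i=1}^mf_i(\mathbf x_{\Delta_i})$, $d_i=\max\{1,\lceil\tfrac12\deg\mathbf g_i\rceil\}$, and consider the polynomial optimization problem $$f^*=\min_{\mathbf x\in\mathbb R^n}\ f(\mathbf x)\quad\text{s.t.}\quad\mathbf g_i(\mathbf x_{\Delta_i})\ge0\ \ \forall i\in[m].$$ Let $\omega\in\mathbb N$ satisfy $2\omega\ge\max\{1,\deg f,\deg\mathbf g_1,\dots,\deg\mathbf g_m\}$ and consider the sparse moment relaxation $$f^*_\omega=\min_{\mathbf y\in\mathbb R^{|\mathcal E_{2\omega}|}}\ \mathscr L_{\mathbf y}(f)\quad\text{s.t.}\quad\mathbb M^\omega_{\Delta_i}(\mathbf y)\succeq0,\ \ \mathbb M^\omega_{\Delta_i}(\mathbf g_i\mathbf y)\succeq0\ \ \forall i\in[m],\quad y_{\mathbf 0}=1.$$ Suppose the cliques satisfy the running intersection property: for every $i\in\{2,\dots,m\}$ there exists $j\in[i-1]$ with $\Delta_i\cap(\Delta_1\cup\dots\cup\Delta_{i-1})\subseteq\Delta_j$. Suppose $\mathbf y$ is an optimal solution of the sparse moment relaxation such that $\operatorname{rank}\mathbb M^\omega_{\Delta_i}(\mathbf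 y)=\operatorname{rank}\mathbb M^{\omega-d_i}_{\Delta_i}(\mathbf y)$ for every $i\in[m]$ and such that for every $i\in\{2,\dots,m\}$ there exists $j\in[i-1]$ with $\Delta_i\cap(\Delta_1\cup\dots\cup\Delta_{i-1})\subseteq\Delta_j$ and $\operatorname{rank}\mathbb M^\omega_{\Delta_i\cap\Delta_j}(\mathbf y)=\operatorname{rank}\mathbb M^{\omega-1}_{\Delta_i\cap\Delta_j}(\mathbf y)$. Then $f^*_\omega=f^*$, and there exist an integer $r\ge\max_{i\in[m]}\operatorname{rank}\mathbb M^\omega_{\Delta_i}(\mathbf y)$, pairwise distinct points $\mathbf x_1,\dots,\mathbf x_r$ satisfying the constraints of the polynomial optimization problem, and scalars $\lambda_1,\dots,\lambda_r>0$, such that $y_\alpha=\sum_{k=1}^r\lambda_k\mathbf x_k^\alpha$ for all $\alpha\in\mathcal E_{2\omega}$ and $\mathbf x_1,\dots,\mathbf x_r$ are all minimizers of the polynomial optimization problem.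
   Context: Notation: $\mathbb N=\{0,1,2,\dots\}$, $[k]=\{1,\dots,k\}$. For $\Delta\subseteq[n]$, $\mathbf x_\Delta$ is the subvector of $\mathbf x\in\mathbb R^n$ indexed by $\Delta$. Vector inequalities are element-wise; $\deg\mathbf g_i$ is the maximum degree of the entries of $\mathbf g_i$ (and $0$ if $N_i=0$); $\succeq0$ means positive semidefinite. Correlatively sparse multi-indices: $\mathcal E_{2\omega}=\bigcup_{i=1}^m\{\alpha\in\mathbb N^n:\ \alpha_k=0\ \forall k\notin\Delta_i,\ \alpha_1+\dots+\alpha_n\le2\omega\}$. Vectors $\mathbf y\in\mathbb R^{|\mathcal E_{2\omega}|}$ are written $\mathbf y=(y_\alpha)_{\alpha\in\mathcal E_{2\omega}}$. Riesz functional: $\mathscr L_{\mathbf y}$ is the linear functional on $\operatorname{span}\{\mathbf x^\alpha:\alpha\in\mathcal E_{2\omega}\}$ with $\mathscr L_{\mathbf y}(\mathbf x^\alpha)=y_\alpha$. Thus $\mathscr L_{\mathbf y}(f)=\langle\mathbf f,\mathbf y\rangle$, where $\mathbf f$ is the coefficient vector of $f$ with respect to the monomials $(\mathbf x^\alpha)_{\alpha\in\mathcal E_{2\omega}}$. Moment matrices: for $\Delta\subseteq[n]$ contained in some clique and $0\le d\le\omega$, $\mathbb M^d_\Delta(\mathbf y)$ is the matrix with rows and columns indexed by the monomials in the variables $\mathbf x_\Delta$ of total degree at most $d$, whose $(p,q)$ entry is $\mathscr L_{\mathbf y}(pq)$. Localizing matrices: $\mathbb M^\omega_{\Delta_i}(\mathbf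 g_i\mathbf y)$ is the block-diagonal matrix with blocks $\mathbb M^\omega_{\Delta_i}(g_{i,k}\mathbf y)$, $k\in[N_i]$, where $\mathbb M^\omega_{\Delta_i}(g_{i,k}\mathbf y)$ is indexed by the monomials in $\mathbf x_{\Delta_i}$ of degree at most $\omega-d_i$ and has $(p,q)$ entry $\mathscr L_{\mathbf y}(g_{i,k}(\mathbf x_{\Delta_i})\,pq)$. *)

(* Defs.v *)
From mathcomp Require Import all_boot all_order all_algebra.
From mathcomp Require Import mpoly.
From mathcomp Require Import classical_sets reals constructive_ereal ereal.

Set Implicit Arguments.
Unset Strict Implicit.
Unset Printing Implicit Defensive.

Import Order.TTheory GRing.Theory Num.Theory.
Local Open Scope ring_scope.

Definition psdmx (R : realType) (k : nat) (M : 'M[R]_k) : Prop :=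
  M^T = M /\ forall v : 'rV[R]_k, 0 <= (v *m M *m v^T) 0 0.

(* [msize] is one plus the total degree, and [msize 0 = 0]; so [mdegp 0 = 0]. *)
Definition mdegp (R : realType) (n : nat) (p : {mpoly R[n]}) : nat :=
  (msize p).-1.

Definition mpow (R : realType) (n : nat) (x : 'rV[R]_n) (a : 'X_{1..n}) : R :=
  \prod_(i < n) x 0 i ^+ a i.

Definition supported (n : nat) (D : {set 'I_n}) (a : 'X_{1..n}) : bool :=
  [forall k, (k \notin D) ==> (a k == 0%N)].

(* For [D = {j_0 < j_1 < ...}], the local variable number [k] is [x_(j_k)]. *)
Definition subvec (R : realType) (n : nat) (D : {set 'I_n}) (x : 'rV[R]_n) :
  'rV[R]_#|D| := \row_k x 0 (enum_val k).

(* [p(x_D)] as a polynomial in all the variables [x_0, ..., x_(n-1)]. *)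
Definition lift_poly (R : realType) (n : nat) (D : {set 'I_n})
  (p : {mpoly R[#|D|]}) : {mpoly R[n]} := p \mPo [tuple 'X_(enum_val k) | k < #|D|].

Lemma meval_lift_poly (R : realType) (n : nat) (D : {set 'I_n})
  (p : {mpoly R[#|D|]}) (x : 'rV[R]_n) :
  (lift_poly p).@[x 0] = p.@[subvec D x 0].
Proof.
rewrite /lift_poly comp_mpoly_meval; apply: meval_eq => k.
by rewrite tnth_mktuple mevalXU mxE.
Qed.

Section MomentRelaxation.

Variables (R : realType) (n m : nat) (Dl : 'I_m -> {set 'I_n}) (w : nat).

Definition cs_index : predArgType :=
  {a : 'X_{1..n < (2 * w).+1} | [exists i, supported (Dl i) a]}.

Definition cs_mnm (a : cs_index) : 'X_{1..n} := bmnm (val a).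

Lemma cs_mnmP (a : 'X_{1..n}) :
  (exists b, cs_mnm b = a) <->
  exists i, (forall k, k \notin Dl i -> a k = 0%N) /\ (mdeg a <= 2 * w)%N.
Proof.
split=> [[b <-]|[i [ai ha]]].
  have /existsP[i /forallP bi] := valP b; exists i; split.
    by move=> k kD; apply/eqP; have := bi k; rewrite kD.
  by have := bmdeg (val b); rewrite ltnS.
have ab : (mdeg a < (2 * w).+1)%N by rewrite ltnS.
have aE : [exists i, supported (Dl i) (BMultinom ab)].
  by apply/existsP; exists i; apply/forallP => k; apply/implyP => /ai /eqP.
by exists (Sub (BMultinom ab) aE).
Qed.

Implicit Type y : {ffun cs_index -> R}.

Definition riesz y (p : {mpoly R[n]}) : R :=
  \sum_(a : cs_index) p@_(cs_mnm a) * y a.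

Lemma rieszX y (a : cs_index) : riesz y 'X_[cs_mnm a] = y a.
Proof.
rewrite /riesz (bigD1 a) //= mcoeffX eqxx mul1r big1 ?addr0 // => b ba.
rewrite mcoeffX; case: eqP => [e|_]; last by rewrite mul0r.
by move: ba; rewrite (val_inj (val_inj (esym e))) eqxx.
Qed.

Definition loc_index (D : {set 'I_n}) (d : nat) : predArgType :=
  {a : 'X_{1..n < d.+1} | supported D a}.

Definition loc_monom (D : {set 'I_n}) (d : nat) (i : 'I_#|loc_index D d|) :
  {mpoly R[n]} := 'X_[bmnm (val (enum_val i))].

Definition moment_mx y (D : {set 'I_n}) (d : nat) : 'M[R]_#|loc_index D d| :=
  \matrix_(i, j) riesz y (loc_monom i * loc_monom j).

Definition localizing_mx y (q : {mpoly R[n]}) (D : {set 'I_n}) (d : nat) :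
  'M[R]_#|loc_index D d| :=
  \matrix_(i, j) riesz y (q * loc_monom i * loc_monom j).

Variables (f : forall i, {mpoly R[#|Dl i|]}) (N : 'I_m -> nat).
Variable g : forall i, 'I_(N i) -> {mpoly R[#|Dl i|]}.

Definition objective : {mpoly R[n]} := \sum_(i < m) lift_poly (f i).

Definition deg_constr (i : 'I_m) : nat := \max_(k < N i) mdegp (g k).

(* [uphalf k] is the ceiling of [k / 2]. *)
Definition half_deg (i : 'I_m) : nat := maxn 1 (uphalf (deg_constr i)).

Definition block_localizing_mx y (i : 'I_m) :
  'M[R]_(\sum_(k < N i) #|loc_index (Dl i) (w - half_deg i)|) :=
  \mxdiag_(k < N i) localizing_mx y (lift_poly (g k)) (Dl i) (w - half_deg i).

Definition pop_feasible (x : 'rV[R]_n) : Prop :=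
  forall (i : 'I_m) (k : 'I_(N i)), 0 <= (g k).@[subvec (Dl i) x 0].

Definition pop_minimizer (x : 'rV[R]_n) : Prop :=
  pop_feasible x /\
  forall z, pop_feasible z -> objective.@[x 0] <= objective.@[z 0].

Definition pop_value : \bar R :=
  ereal_inf [set (objective.@[x 0])%:E | x in pop_feasible]%classic.

(* The condition [y_0 = 1] is not vacuous when [0 < m]: see [cs_mnmP]. *)
Definition relax_feasible y : Prop :=
  [/\ forall i : 'I_m, psdmx (moment_mx y (Dl i) w),
      forall i : 'I_m, psdmx (block_localizing_mx y i)
    & forall a : cs_index, cs_mnm a = 0%MM -> y a = 1].

Definition relax_minimizer y : Prop :=
  relax_feasible y /\
  forall z, relax_feasible z -> riesz y objective <= riesz z objective.

Definition relax_value : \bar R :=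
  ereal_inf [set (riesz y objective)%:E | y in relax_feasible]%classic.

Definition rip_parent (i j : 'I_m) : bool :=
  (j < i)%N && (Dl i :&: \bigcup_(k < m | (k < i)%N) Dl k \subset Dl j).

End MomentRelaxation.

(* Main.v *)
(* On each clique the rank condition makes the moment matrix flat: writing it
   as a Gram matrix of vectors [vec a] indexed by monomials, multiplication by
   [x_k] becomes a well-defined family of commuting symmetric matrices, whose
   joint eigenvalues are the atoms of a measure representing the moments.
   As the Vandermonde matrix of the atoms has full rank, there are
   interpolation polynomials at the atoms; tested on their squares, the
   localizing matrices show that the atoms satisfy the constraints.  On an
   overlap of two cliques, flatness makes the representing measure unique, so
   that the measures of the cliques have the same marginal there and can be
   glued, one clique at a time, along the running intersection order.  The
   objective averages to the optimal value over the resulting feasible atoms,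
   and Dirac measures show that this value is a lower bound on the feasible
   set; hence every atom is a minimizer. *)
From HB Require Import structures.
Require Import Defs.
From mathcomp Require Import all_boot all_order all_algebra.
From mathcomp Require Import mpoly complex ring lra zify.
From mathcomp Require Import classical_sets reals constructive_ereal ereal.

Set Implicit Arguments.
Unset Strict Implicit.
Unset Printing Implicit Defensive.

Import Order.TTheory GRing.Theory Num.Theory.
Local Open Scope ring_scope.

(** * Real symmetric matrices *)

Section LinearAlgebra.
Variable R : realType.
Implicit Types n : nat.

Lemma sym11 (A : 'M[R]_1) : A^T = A.
Proof. by apply/matrixP => i j; rewrite !ord1 mxE. Qed.

Lemma mx11_sqr_eq0 n (v : 'rV[R]_n) : (v *m v^T) 0 0 = 0 -> v = 0.
Proof.
rewrite mxE => /eqP; rewrite psumr_eq0; last first.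
  by move=> i _; rewrite mxE -expr2 sqr_ge0.
move=> /allP v0; apply/rowP => i; have := v0 i (mem_index_enum _).
by rewrite mxE mulf_eq0 orbb mxE => /eqP.
Qed.

Lemma psd_block n (M : 'M[R]_(1 + n)) : psdmx M ->
  exists a b C, [/\ M = block_mx a%:M b b^T C, C^T = C &
    forall s (v : 'rV_n), 0 <= s ^+ 2 * a + (s * (b *m v^T) 0 0) *+ 2
       + (v *m C *m v^T) 0 0].
Proof.
move=> [sM pM]; have eM := submxK M.
have := congr1 trmx eM; rewrite tr_block_mx sM -[RHS]eM.
case/eq_block_mx => _ _ /esym e2 e3.
have e1 := mx11_scalar (ulsubmx M).
exists (ulsubmx M 0 0), (ursubmx M), (drsubmx M); split=> //.
  by rewrite -e2 -e1.
move=> s v; have := pM (row_mx s%:M v).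
rewrite -{1}eM e2 tr_row_mx mul_row_block mul_row_col.
rewrite tr_scalar_mx !mulmxDl !mul_scalar_mx.
rewrite [v *m _ *m s%:M]mul_mx_scalar -(sym11 (v *m _)) trmx_mul trmxK.
rewrite e1 mul_mx_scalar -!scalemxAl !mxE eqxx mulr1n.
congr (_ <= _); ring.
Qed.

(** Cholesky induction on the size: a positive pivot leaves a Schur complement, a zero pivot forces
    a zero row. [row_full V] makes [r] the rank of [M]. *)
Lemma psd_factor n (M : 'M[R]_n) : psdmx M ->
  exists r (V : 'M[R]_(n, r)), row_full V /\ M = V *m V^T.
Proof.
elim: n M => [|n IH] M.
  exists 0%N, 0; split; last by rewrite [M]flatmx0 [RHS]flatmx0.
  by rewrite /row_full mxrank0.
rewrite -[n.+1]/(1 + n)%N in M *; case/psd_block => [a [b [C [-> sC q]]]].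
have a0 : 0 <= a.
  by have := q 1 0; rewrite trmx0 !mulmx0 !mxE expr1n; move=> h; lra.
case: (eqVneq a 0) => [e|an0]; last first.
  have [|r [V [fV eV]]] := IH (C - a^-1 *: (b^T *m b)).
    split; first by rewrite linearB linearZ /= trmx_mul trmxK sC.
    (* This [s] minimizes the quadratic in [s]; the minimum is the Schur complement form at [v]. *)
    move=> v; have := q (- (b *m v^T) 0 0 / a) v.
    set x := (b *m v^T) 0 0; rewrite mulmxBr mulmxBl -scalemxAr -scalemxAl.
    have -> : v *m (b^T *m b) *m v^T = (x ^+ 2)%:M.
      rewrite mulmxA -mulmxA [b *m _]mx11_scalar -/x mul_mx_scalar.
      by rewrite -[v *m _](sym11) trmx_mul trmxK [b *m _]mx11_scalar -/x
        scale_scalar_mx.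
    rewrite [X in _ -> _ <= X]mxE [X in _ -> _ <= _ + X]mxE.
    rewrite [X in _ -> _ <= _ - X]mxE [(x ^+ 2)%:M _ _]mxE eqxx mulr1n.
    by move=> h; rewrite (le_trans h) // le_eqVlt; apply/orP; left; apply/eqP; field.
  have sa : Num.sqrt a != 0 by rewrite sqrtr_eq0 -ltNge lt_neqAle eq_sym an0.
  have s2 : Num.sqrt a ^+ 2 = a by rewrite sqr_sqrtr.
  exists (1 + r)%N, (block_mx (Num.sqrt a)%:M 0 ((Num.sqrt a)^-1 *: b^T) V).
  split.
    have /row_fullP[Z ZV] := fV; apply/row_fullP.
    set c := _ *: _; exists (block_mx (Num.sqrt a)^-1%:M 0
      (- (Z *m c *m (Num.sqrt a)^-1%:M)) Z).
    rewrite mulmx_block !mulmx0 !mul0mx !addr0 add0r ZV mulNmx -!mulmxA.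
    by rewrite -scalar_mxM mulVf // mulmx1 addNr scalar_mx_block.
  rewrite tr_block_mx mulmx_block !trmx0 !mulmx0 !mul0mx !addr0 -eV.
  rewrite tr_scalar_mx -scalar_mxM -expr2 s2 linearZ /= trmxK.
  rewrite mul_scalar_mx mul_mx_scalar !scalerA mulfV // !scale1r.
  rewrite -scalemxAl -scalemxAr scalerA -invfM -expr2 s2.
  by rewrite addrC subrK.
(* With a zero pivot the form is affine in [s]; if [b] were nonzero, the [s] chosen below would give
   it the value -1 at [v = b]. *)
have b0 : b = 0.
  apply: mx11_sqr_eq0; set t := _ 0 0; apply/eqP/negPn/negP => t0.
  have := q (- ((b *m C *m b^T) 0 0 + 1) / (t *+ 2)) b.
  rewrite -/t e mulr0 add0r; set c := (b *m C *m _) 0 0.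
  have -> : (- (c + 1) / (t *+ 2) * t) *+ 2 = - (c + 1) by field.
  by rewrite opprD addrAC addNr add0r oppr_ge0 ler10.
have [|r [V [fV eV]]] := IH C.
  by split=> // v; have := q 0 v; rewrite expr0n /= !mul0r mul0rn !add0r.
exists r, (col_mx 0 V); split.
  have /row_fullP[Z ZV] := fV; apply/row_fullP; exists (row_mx 0 Z).
  by rewrite mul_row_col mul0mx add0r.
rewrite tr_col_mx mul_col_row -eV e b0 !trmx0 !mul0mx mulmx0.
by congr block_mx; apply/matrixP => i j; rewrite !mxE mul0rn.
Qed.

(** Over the complex numbers [A] is Hermitian with real spectrum, so its minimal polynomial divides
    a product of distinct real linear factors; this divisibility descends to [R]. *)
Lemma symmetric_diagonalizable n (A : 'M[R]_n) : A^T = A -> diagonalizable A.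
Proof.
case: n A => [|n] A sA.
  by rewrite [A]flatmx0; exact: diagonalizable0.
apply/diagonalizableP; pose f := real_complex R; pose A' := map_mx f A.
have hA' : A' \is hermsymmx.
  apply: realsym_hermsym; last first.
    by apply/mxOverP => i j; rewrite mxE complex_real.
  by apply/is_hermitianmxP; rewrite expr0 scale1r map_mx_id //;
    apply/matrixP => i j; rewrite !mxE -[in LHS]sA mxE.
have := hA'.
move=> /hermitian_normalmx/orthomx_spectralP; set P := spectralmx _ => eA.
have Pu : P \in unitmx by apply: spectral_unit.
have /mxOverP dR := hermitian_spectral_diag_real hA'.
set d := spectral_diag _ in eA dR.
pose d0 : 'rV_n.+1 := map_mx (@complex.Re R) d.
have ed : diag_mx d = map_mx f (diag_mx d0).
  apply/matrixP => i j; rewrite !mxE; case: eqP => _; rewrite ?mulr1n ?mulr0n //.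
  by rewrite /f -[LHS]RRe_real.
exists (undup [seq d0 0 i | i <- enum 'I_n.+1]); first exact: undup_uniq.
rewrite -(dvdp_map f) -mxminpoly_map -/A' eA -conjVmx //.
rewrite mxminpoly_uconj ?unitmx_inv // ed mxminpoly_map dvdp_map.
by rewrite mxminpoly_diag.
Qed.

End LinearAlgebra.

(** * Polynomials in a subset of the variables *)

Section LocalPolynomials.
Variables (R : realType) (n : nat).
Implicit Types (D : {set 'I_n}) (a b : 'X_{1..n}) (p q : {mpoly R[n]}).

Lemma mpowE (x : 'rV[R]_n) a : mpow x a = 'X_[a].@[x 0].
Proof. by rewrite mevalX. Qed.

Lemma mpowD (x : 'rV[R]_n) a b : mpow x (a + b)%MM = mpow x a * mpow x b.
Proof. by rewrite !mpowE mpolyXD mevalM. Qed.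

Lemma supportedP D a : reflect (forall k, k \notin D -> a k = 0%N) (supported D a).
Proof.
apply: (iffP forallP) => h k; last by apply/implyP => /h ->.
by move=> kD; have := h k; rewrite kD => /eqP.
Qed.

Lemma supported0 D : supported D 0%MM.
Proof. by apply/supportedP => k _; rewrite mnm0E. Qed.

Lemma supportedU D k : k \in D -> supported D U_(k)%MM.
Proof.
move=> kD; apply/supportedP => l; rewrite mnm1E.
by case: eqP => // <-; rewrite kD.
Qed.

Lemma supportedD D a b : supported D a -> supported D b -> supported D (a + b)%MM.
Proof.
move=> /supportedP ha /supportedP hb; apply/supportedP => k kD.
by rewrite mnmDE ha ?hb.
Qed.

Lemma supportedS D D' a : D \subset D' -> supported D a -> supported D' a.
Proof.
move=> /fintype.subsetP DD' /supportedP ha; apply/supportedP => k kD'.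
by apply: ha; apply: contra kD' => /DD'.
Qed.

Lemma eq_mpow D (x z : 'rV[R]_n) a : supported D a ->
  (forall k, k \in D -> x 0 k = z 0 k) -> mpow x a = mpow z a.
Proof.
move=> /supportedP ha e; apply: eq_bigr => k _.
by case: (boolP (k \in D)) => [/e -> //|/ha ->]; rewrite !expr0.
Qed.

(** Local polynomials stay in the ring of all [n] variables, so that those of different cliques can
    be compared and multiplied. *)
Definition deg_on D d : pred {mpoly R[n]} :=
  fun p => all (fun a => supported D a && (mdeg a <= d)%N) (msupp p).

Lemma deg_onP D d p :
  reflect {in msupp p, forall a, supported D a && (mdeg a <= d)%N} (deg_on D d p).
Proof. exact: allP. Qed.

Lemma deg_onW D d d' p : (d <= d')%N -> deg_on D d p -> deg_on D d' p.
Proof.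
move=> dd' /deg_onP h; apply/deg_onP => a /h /andP[-> /= ha].
exact: leq_trans dd'.
Qed.

Lemma deg_onS D D' d p : D \subset D' -> deg_on D d p -> deg_on D' d p.
Proof.
move=> DD' /deg_onP h; apply/deg_onP => a /h /andP[ha ->].
by rewrite (supportedS DD').
Qed.

Lemma deg_onX D d a : supported D a -> (mdeg a <= d)%N -> deg_on D d 'X_[a].
Proof. by move=> sa da; apply/deg_onP => b; rewrite msuppX inE => /eqP ->; rewrite sa. Qed.

Lemma deg_onC D d c : deg_on D d c%:MP.
Proof.
apply/deg_onP => a; rewrite msuppC; case: ifP => // _.
by rewrite inE => /eqP ->; rewrite supported0 mdeg0.
Qed.

Lemma deg_on1 D d : deg_on D d 1.
Proof. by rewrite -mpolyC1; exact: deg_onC. Qed.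

Lemma deg_onD D d p q : deg_on D d p -> deg_on D d q -> deg_on D d (p + q).
Proof.
move=> /deg_onP hp /deg_onP hq; apply/deg_onP => a /msuppD_le.
by rewrite mem_cat => /orP[/hp|/hq].
Qed.

Lemma deg_onZ D d c p : deg_on D d p -> deg_on D d (c *: p).
Proof. by move=> /deg_onP hp; apply/deg_onP => a /msuppZ_le /hp. Qed.

Lemma deg_onB D d p q : deg_on D d p -> deg_on D d q -> deg_on D d (p - q).
Proof. by move=> hp hq; rewrite -scaleN1r; apply: deg_onD => //; apply: deg_onZ. Qed.

Lemma deg_on_sum D d (I : Type) (s : seq I) (P : pred I) (F : I -> {mpoly R[n]}) :
  (forall i, P i -> deg_on D d (F i)) -> deg_on D d (\sum_(i <- s | P i) F i).
Proof.
move=> h; apply: (big_ind (deg_on D d)) => //; first by rewrite -mpolyC0; exact: deg_onC.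
exact: deg_onD.
Qed.

Lemma deg_onM D d d' p q : deg_on D d p -> deg_on D d' q -> deg_on D (d + d') (p * q).
Proof.
move=> /deg_onP hp /deg_onP hq; apply/deg_onP => a /msuppM_le.
case/allpairsP => -[b c] /= [/hp /andP[sb db] /hq /andP[sc dc] ->].
by rewrite supportedD // mdegD leq_add.
Qed.

Definition loc_mnm D d (i : 'I_#|loc_index D d|) : 'X_{1..n} :=
  bmnm (val (enum_val i)).

Lemma loc_mnm_supp D d (i : 'I_#|loc_index D d|) : supported D (loc_mnm i).
Proof. exact: (valP (enum_val i)). Qed.

Lemma loc_mnm_deg D d (i : 'I_#|loc_index D d|) : (mdeg (loc_mnm i) <= d)%N.
Proof. by rewrite -ltnS bmdeg. Qed.

Lemma loc_mnm_ex D d a : supported D a -> (mdeg a <= d)%N ->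
  exists i : 'I_#|loc_index D d|, loc_mnm i = a.
Proof.
move=> sa; rewrite -ltnS => da.
pose b : loc_index D d := Sub (BMultinom da) sa.
by exists (enum_rank b); rewrite /loc_mnm enum_rankK.
Qed.

Lemma loc_monomE D d (i : 'I_#|loc_index D d|) : loc_monom R i = 'X_[loc_mnm i].
Proof. by []. Qed.

Lemma mnm_succ a s : mdeg a = s.+1 ->
  exists b k, a = (b + U_(k))%MM /\ mdeg b = s.
Proof.
move=> ea; have [k ak] : exists k, a k != 0%N.
  apply/existsP; rewrite -[[exists _, _]]negbK; apply/negP => /existsPn h.
  have a0 : a = 0%MM by apply/mnmP => k; rewrite mnm0E; apply/eqP/negPn/h.
  by move: ea; rewrite a0 mdeg0.
have e : a = (a - U_(k) + U_(k))%MM by rewrite submK // lep1mP.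
exists (a - U_(k))%MM, k; split=> //.
by move: ea; rewrite {1}e mdegD mdeg1 addn1 => -[].
Qed.

Lemma supportedDr D a b : supported D (a + b)%MM -> supported D a /\ supported D b.
Proof.
move=> /supportedP h; split; apply/supportedP => k /h /eqP;
  by rewrite mnmDE addn_eq0 => /andP[/eqP ea /eqP eb].
Qed.

Lemma supportedUr D k : supported D U_(k)%MM -> k \in D.
Proof.
move=> /supportedP h; apply/negPn/negP => /h; by rewrite mnm1E eqxx.
Qed.

Lemma mnm_split a s : (s <= mdeg a)%N ->
  exists b c, [/\ a = (b + c)%MM, mdeg b = s & mdeg c = (mdeg a - s)%N].
Proof.
elim: s => [|s IH] hs; first by exists 0%MM, a; rewrite add0m mdeg0 subn0.
have [b [c [ea eb ec]]] := IH (ltnW hs).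
have [|c' [k [ec' dc']]] := @mnm_succ c (mdeg a - s.+1)%N.
  by rewrite ec -subSn.
exists (b + U_(k))%MM, c'; split => //; last by rewrite mdegD mdeg1 eb addn1.
by rewrite ea ec' -addmA [(U_(k) + _)%MM]addmC.
Qed.

End LocalPolynomials.

(** * Atomic representations of linear functionals *)

Section AtomicFunctionals.
Variables (R : realType) (n : nat).
Implicit Types (D : {set 'I_n}) (a b : 'X_{1..n}) (p q : {mpoly R[n]}).

Definition integral_on (T : finType) (x : T -> 'rV[R]_n) (lam : T -> R) p : R :=
  \sum_t lam t * p.@[x t 0].

Lemma integral_sqr_eq0 (T : finType) (x : T -> 'rV[R]_n) (lam : T -> R) p t :
  (forall t, 0 <= lam t) -> integral_on x lam (p * p) = 0 ->
  lam t != 0 -> p.@[x t 0] = 0.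
Proof.
move=> lam0 /eqP; rewrite psumr_eq0 => [/allP/(_ t)|s _]; last first.
  by rewrite mulr_ge0 // mevalM -expr2 sqr_ge0.
rewrite mem_index_enum => /(_ isT); rewrite mevalM mulf_eq0 => /orP[/eqP-> |].
  by rewrite eqxx.
by rewrite mulf_eq0 orbb => /eqP.
Qed.

Variable L : {scalar {mpoly R[n]}}.

(** The weights may have any sign: [flat_extension] first builds a representation and derives
    positivity from it. *)
Definition represents D d (T : finType) (x : T -> 'rV[R]_n) (lam : T -> R) :=
  forall p, deg_on D d p -> L p = integral_on x lam p.

Lemma represents_mnm D d (T : finType) (x : T -> 'rV[R]_n) (lam : T -> R) :
  (forall a, supported D a -> (mdeg a <= d)%N ->
     L 'X_[a] = \sum_t lam t * mpow (x t) a) ->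
  represents D d x lam.
Proof.
move=> h p /deg_onP hp; rewrite {1}[p]mpolyE linear_sum /=.
transitivity (\sum_(a <- msupp p) \sum_t lam t * (p@_a * mpow (x t) a)).
  rewrite big_seq [RHS]big_seq; apply: eq_bigr => a /hp /andP[sa da].
  rewrite linearZ /= h // mulr_sumr; apply: eq_bigr => t _; ring.
rewrite exchange_big; apply: eq_bigr => t _ /=.
by rewrite mevalE -mulr_sumr.
Qed.

Definition poly_of D d (c : 'rV[R]_#|loc_index D d|) : {mpoly R[n]} :=
  \sum_i c 0 i *: loc_monom R i.

Lemma deg_on_poly_of D d c : deg_on D d (@poly_of D d c).
Proof.
apply: deg_on_sum => i _; apply: deg_onZ; apply: deg_onX.
  exact: loc_mnm_supp.
exact: loc_mnm_deg.
Qed.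

Definition localize q D d : 'M[R]_#|loc_index D d| :=
  \matrix_(i, j) L (q * loc_monom R i * loc_monom R j).

Lemma localizeE q D d (c c' : 'rV_#|loc_index D d|) :
  (c *m localize q D d *m c'^T) 0 0 = L (q * poly_of c * poly_of c').
Proof.
rewrite -mulmxA mxE /poly_of [q * _]mulr_sumr mulr_suml linear_sum /=.
apply: eq_bigr => i _; rewrite mxE !mulr_sumr linear_sum; apply: eq_bigr => j _.
rewrite !mxE -[X in _ = X]/(L _) -!scalerAr -scalerAl !linearZ /=; ring.
Qed.

Definition hankel D d : 'M[R]_#|loc_index D d| :=
  \matrix_(i, j) L (loc_monom R i * loc_monom R j).

Lemma hankelE D d : hankel D d = localize 1 D d.
Proof. by apply/matrixP => i j; rewrite !mxE mul1r. Qed.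

Definition vander (T : nat) (x : 'I_T -> 'rV[R]_n) D d : 'M[R]_(#|loc_index D d|, T) :=
  \matrix_(i, t) mpow (x t) (loc_mnm i).

Lemma hankel_vander D d e r (x : 'I_r -> 'rV[R]_n) lam : (d + d <= e)%N ->
  represents D e x lam ->
  hankel D d = vander x D d *m (diag_mx (\row_t lam t) *m (vander x D d)^T).
Proof.
move=> de h; apply/matrixP => i j; rewrite mxE h; last first.
  by apply: deg_onW de _; apply: deg_onM; apply: deg_onX;
    rewrite ?loc_mnm_supp ?loc_mnm_deg.
rewrite mxE; apply: eq_bigr => t _; rewrite mul_diag_mx !mxE mevalM -!mpowE.
ring.
Qed.

Lemma rank_hankel_le D d e r (x : 'I_r -> 'rV[R]_n) lam : (d + d <= e)%N ->
  represents D e x lam -> (\rank (hankel D d) <= r)%N.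
Proof.
move=> de h; rewrite (hankel_vander de h).
by rewrite (leq_trans (mxrankM_maxl _ _)) // rank_leq_col.
Qed.

(** The Hankel matrix factors through the Vandermonde matrix, so rank [r] gives the latter a left
    inverse, whose rows are the coefficients of the interpolation polynomials. *)
Lemma interpolation D d e r (x : 'I_r -> 'rV[R]_n) lam : (d + d <= e)%N ->
  represents D e x lam -> \rank (hankel D d) = r ->
  exists c : 'I_r -> 'rV[R]_#|loc_index D d|,
    forall j k, (poly_of (c j)).@[x k 0] = (j == k)%:R.
Proof.
move=> de h rk; have : row_full (vander x D d).
  rewrite /row_full eqn_leq rank_leq_col /= -{1}rk (hankel_vander de h).
  exact: mxrankM_maxl.
move=> /row_fullP[C CV]; exists (fun j => row j C) => j k.
have := congr1 (fun M : 'M__ => M j k) CV; rewrite !mxE => <-.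
rewrite raddf_sum /=; apply: eq_bigr => i _.
by rewrite mevalZ !mxE mpowE.
Qed.

Lemma interpolation_inj D d r (x : 'I_r -> 'rV[R]_n)
  (c : 'I_r -> 'rV[R]_#|loc_index D d|) :
  (forall j k, (poly_of (c j)).@[x k 0] = (j == k)%:R) -> injective x.
Proof.
move=> h j k e; have := h j j; rewrite e h eqxx.
by case: eqP => // _ /eqP; rewrite eq_sym oner_eq0.
Qed.

(** The square of an interpolation polynomial isolates one atom in the quadratic form. Taking
    [q = 1] yields nonnegative weights, taking a constraint yields feasible atoms. *)
Lemma localize_ge0 D d e e' r (x : 'I_r -> 'rV[R]_n) lam q :
  (d + d + e' <= e)%N -> represents D e x lam -> \rank (hankel D d) = r ->
  deg_on D e' q -> psdmx (localize q D d) ->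
  forall j, 0 <= lam j * q.@[x j 0].
Proof.
move=> de h rk qd [_ psd] j.
have [c cE] := interpolation (leq_trans (leq_addr _ _) de) h rk.
have := psd (c j); rewrite localizeE h; last first.
  apply: deg_onW de _; rewrite addnC addnA.
  by do 2?apply: deg_onM => //; exact: deg_on_poly_of.
rewrite /integral_on (bigD1 j) //= big1 => [|k kj]; last first.
  by rewrite !mevalM cE eq_sym (negbTE kj) !mulr0.
by rewrite !mevalM cE eqxx !mulr1 addr0.
Qed.

End AtomicFunctionals.

(** * Flat extension *)

Section FlatExtension.
Variables (R : realType) (n : nat) (L : {scalar {mpoly R[n]}}).
Implicit Types (a b : 'X_{1..n}) (p q : {mpoly R[n]}).

Lemma mnm_ind_on D w (P : 'X_{1..n} -> Prop) : P 0%MM ->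
  (forall a k, supported D a -> (mdeg a < w)%N -> k \in D -> P a ->
     P (a + U_(k))%MM) ->
  forall a, supported D a -> (mdeg a <= w)%N -> P a.
Proof.
move=> P0 PU a; have [s] := ubnP (mdeg a); elim: s a => // s IH a.
case ea : (mdeg a) => [|s'].
  by move/eqP: ea; rewrite mdeg_eq0 => /eqP ->.
have [b [k [-> <-]]] := mnm_succ ea.
rewrite ltnS => bs /supportedDr[sb /supportedUr kD] bw.
by apply: PU => //; apply: IH => //; apply: ltnW.
Qed.

Lemma hankel_gram D w r (V : 'M[R]_(_, r)) : hankel L D w = V *m V^T ->
  exists vec : 'X_{1..n} -> 'rV[R]_r, forall a b,
    supported D a -> (mdeg a <= w)%N -> supported D b -> (mdeg b <= w)%N ->
    vec a *m (vec b)^T = (L 'X_[a + b])%:M.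
Proof.
move=> eV.
(* The default 0 occurs only off [D] or beyond degree [w], where nothing is claimed. *)
exists (fun a => if [pick i : 'I_#|loc_index D w| | loc_mnm i == a] is Some i
                 then row i V else 0) => a b sa da sb db.
have pickE c : supported D c -> (mdeg c <= w)%N -> exists2 i, loc_mnm i = c &
    (if [pick i : 'I_#|loc_index D w| | loc_mnm i == c] is Some i
                 then row i V else 0) = row i V.
  move=> sc dc; case: pickP => [i /eqP ei|]; first by exists i.
  by have [i ei] := loc_mnm_ex sc dc => /(_ i); rewrite ei eqxx.
have [i ei ->] := pickE a sa da; have [j ej ->] := pickE b sb db.
rewrite tr_row [LHS]mx11_scalar; congr _%:M.
have := congr1 (fun M : 'M__ => M i j) eV; rewrite !mxE -ei -ej mpolyXD => ->.
by apply: eq_bigr => k _; rewrite !mxE.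
Qed.

(* [X k] is the matrix of multiplication by [x_k] on the quotient of the
   polynomials of degree less than [w] by the kernel of the Hankel form;
   flatness makes this quotient equal to that of degree [w], so that it is
   stable under multiplication. *)
Lemma multiplication_operators D w : (0 < w)%N -> psdmx (hankel L D w) ->
  \rank (hankel L D w) = \rank (hankel L D (w - 1)) ->
  exists (vec : 'X_{1..n} -> 'rV[R]_(\rank (hankel L D w)))
         (X : 'I_n -> 'M[R]_(\rank (hankel L D w))),
  [/\ forall a b, supported D a -> (mdeg a <= w)%N ->
        supported D b -> (mdeg b <= w)%N ->
        vec a *m (vec b)^T = (L 'X_[a + b])%:M,
      forall k, (X k)^T = X k,
      forall k l, X k *m X l = X l *m X k,
      forall k, k \notin D -> X k = 0 &
      forall a k, supported D a -> (mdeg a < w)%N -> k \in D ->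
        vec a *m X k = vec (a + U_(k))%MM].
Proof.
move=> w0 /psd_factor[r [V [fV eV]]].
have rk : \rank (hankel L D w) = r.
  by rewrite eV mxrankMfree ?(eqP fV) // /row_free mxrank_tr.
rewrite {1}rk => rk1; rewrite rk.
have [vec vecP] := hankel_gram eV.
pose W := \matrix_(i < #|loc_index D (w - 1)|) vec (loc_mnm i).
have w1 : (w - 1 < w)%N by rewrite subn1 prednK.
have ldeg (i : 'I_#|loc_index D (w - 1)|) : (mdeg (loc_mnm i) < w)%N.
  by apply: leq_ltn_trans w1; apply: loc_mnm_deg.
have lsupp (i : 'I_#|loc_index D (w - 1)|) : supported D (loc_mnm i).
  exact: loc_mnm_supp.
have gram n1 n2 (A : 'M[R]_(n1, r)) (B : 'M_(n2, r)) i j :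
    (A *m B^T) i j = (row i A *m (row j B)^T) 0 0.
  by rewrite !mxE; apply: eq_bigr => k _; rewrite !mxE.
have WW : hankel L D (w - 1) = W *m W^T.
  apply/matrixP => i j; rewrite gram !rowK (vecP _ _ (lsupp i) (ltnW (ldeg i)) (lsupp j) (ltnW (ldeg j))).
  by rewrite !mxE eqxx mulr1n mpolyXD.
(* Flatness enters here: the vectors of degree below [w] already span the whole space, so [W] can be
   cancelled on the left and [W^T] on the right. *)
have fW : row_full W.
  by rewrite /row_full eqn_leq rank_leq_col [leqLHS]rk1 WW mxrankM_maxl.
have [Z ZW] := row_fullP fW.
have WZ : W^T *m Z^T = 1%:M by rewrite -trmx_mul ZW trmx1.
have cancelW (A B : 'M[R]_r) : W *m A *m W^T = W *m B *m W^T -> A = B.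
  move=> /(congr1 (fun M => Z *m M *m Z^T)).
  by rewrite !mulmxA ZW !mul1mx -!mulmxA !WZ !mulmx1.
pose Wk k := \matrix_(i < #|loc_index D (w - 1)|) vec (loc_mnm i + U_(k))%MM.
have degU k (i : 'I_#|loc_index D (w - 1)|) : (mdeg (loc_mnm i + U_(k)) <= w)%N.
  by rewrite mdegD mdeg1 addn1.
(* The value 0 off [D] later makes the atoms vanish in these coordinates. *)
pose X k := if k \in D then Z *m Wk k else 0.
have suppU k (i : 'I_#|loc_index D (w - 1)|) : k \in D ->
    supported D (loc_mnm i + U_(k)).
  by move=> kD; rewrite supportedD ?loc_mnm_supp ?supportedU.
have WkW k : k \in D -> Wk k *m W^T = W *m (Wk k)^T.
  move=> kD; apply/matrixP => i j; rewrite [LHS]gram [RHS]gram !rowK.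
  rewrite (vecP _ _ (suppU k i kD) (degU k i) (lsupp j) (ltnW (ldeg j))).
  rewrite (vecP _ _ (lsupp i) (ltnW (ldeg i)) (suppU k j kD) (degU k j)).
  by rewrite -!addmA [(U_(k) + _)%MM]addmC.
(* [Z] is only a left inverse of [W], so the equation is checked after multiplication by [W^T],
   where [WkW] moves [W] next to [Z]. *)
have WX k : k \in D -> W *m X k = Wk k.
  move=> kD; rewrite /X kD.
  have : W *m (Z *m Wk k) *m W^T = Wk k *m W^T.
    by rewrite -!mulmxA WkW // [Z *m _]mulmxA ZW mul1mx.
  by move=> /(congr1 (mulmx^~ Z^T)); rewrite -!mulmxA WZ !mulmx1.
have XT k : (X k)^T = X k.
  case: (boolP (k \in D)) => kD; last by rewrite /X (negbTE kD) trmx0.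
  by apply: cancelW; rewrite WX // WkW // -WX // trmx_mul !mulmxA.
exists vec, X; split=> // [k l|k kD|a k sa da kD].
- case: (boolP (k \in D)) => kD; last by rewrite /X (negbTE kD) mul0mx mulmx0.
  case: (boolP (l \in D)) => lD; last by rewrite /X (negbTE lD) mul0mx mulmx0.
  apply: cancelW; rewrite !mulmxA !WX // -!mulmxA.
  (* By symmetry of the operators both sides become products [Wk k *m (Wk l)^T], up to exchanging
     [k] and [l]; their entries are moments of degree at most [2 * w], symmetric in [k] and [l]. *)
  rewrite -[in LHS](XT l) -[in RHS](XT k) -!trmx_mul !WX //.
  apply/matrixP => i j; rewrite [LHS]gram [RHS]gram !rowK.
  rewrite (vecP _ _ (suppU k i kD) (degU k i) (suppU l j lD) (degU l j)).
  rewrite (vecP _ _ (suppU l i lD) (degU l i) (suppU k j kD) (degU k j)).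
  congr ((L 'X_[_])%:M 0 0).
  by rewrite -!addmA [(U_(k) + _)%MM]addmC [(U_(l) + (_ + _))%MM]addmC -!addmA
    [(U_(l) + _)%MM]addmC.
- by rewrite /X (negbTE kD).
have [i <-] : exists i : 'I_#|loc_index D (w - 1)|, loc_mnm i = a.
  by apply: loc_mnm_ex; rewrite // subn1 -ltnS prednK.
by rewrite -[vec (loc_mnm i)](rowK (fun i => vec (loc_mnm i))) -row_mul WX // rowK.
Qed.

(** The flat extension theorem of Curto and Fialkow. Fixing the coordinates off [D] to 0 gives each
    local atom one canonical place in the full space. *)
Theorem flat_extension D w : (0 < w)%N -> psdmx (hankel L D w) ->
  \rank (hankel L D w) = \rank (hankel L D (w - 1)) ->
  exists (x : 'I_(\rank (hankel L D w)) -> 'rV[R]_n)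
         (lam : 'I_(\rank (hankel L D w)) -> R),
  [/\ forall j, 0 <= lam j, represents L D (2 * w) x lam &
      forall j k, k \notin D -> x j 0 k = 0].
Proof.
move=> w0 psd rk; have := multiplication_operators w0 psd rk.
set r := \rank _ => -[vec [X [vecP XT Xcomm X0 vecX]]].
have [P Pu Pdiag] : codiagonalizable [seq X k | k <- enum 'I_n].
  apply/codiagonalizableP; split=> [_ _ /mapP[k _ ->] /mapP[l _ ->]|_ /mapP[k _ ->]].
    exact: Xcomm.
  exact: symmetric_diagonalizable.
have /fin_all_exists[d dP] k : exists d, P *m X k = diag_mx d *m P.
  have /allP/(_ (X k)) /= := Pdiag.
  rewrite map_f ?mem_enum // => /(_ isT)/diagonalizable_forPex[d /(simmxP Pu)].
  by exists d.
(* Atom [j] collects the eigenvalues of all [X k] at row [j] of [P], a common left eigenvector.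
   Inserting [invmx P *m P] then splits the Gram product into [u] and [t], whose [j]-th entries
   scale with [mpow (x j)]. *)
pose x (j : 'I_r) : 'rV[R]_n := \row_k d k 0 j.
pose u a := vec a *m invmx P; pose t b := P *m (vec b)^T.
have uM a k : supported D a -> (mdeg a < w)%N -> k \in D ->
    u (a + U_(k))%MM = u a *m diag_mx (d k).
  move=> sa da kD; rewrite /u -vecX // -!mulmxA; congr (_ *m _).
  by rewrite -[X k](mulKmx Pu) dP !mulmxA mulmxK.
have tM a k : supported D a -> (mdeg a < w)%N -> k \in D ->
    t (a + U_(k))%MM = diag_mx (d k) *m t a.
  by move=> sa da kD; rewrite /t -vecX // trmx_mul XT !mulmxA dP.
have mpowU a k j : mpow (x j) (a + U_(k))%MM = mpow (x j) a * d k 0 j.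
  by rewrite mpowD [mpow _ U_(k)]mpowE mevalXU mxE.
have uE a j : supported D a -> (mdeg a <= w)%N -> u a 0 j = u 0%MM 0 j * mpow (x j) a.
  move=> sa da; move: a sa da; apply: mnm_ind_on => [|a k sa da kD IH].
    by rewrite mpowE mpolyX0 meval1 mulr1.
  by rewrite uM // mul_mx_diag mxE IH mpowU mulrA.
have tE a j : supported D a -> (mdeg a <= w)%N -> t a j 0 = t 0%MM j 0 * mpow (x j) a.
  move=> sa da; move: a sa da; apply: mnm_ind_on => [|a k sa da kD IH].
    by rewrite mpowE mpolyX0 meval1 mulr1.
  by rewrite tM // mul_diag_mx mxE IH mpowU mulrCA [d k 0 j * _]mulrC.
(* Positivity of the weights is not visible here, since [P] need not be
   orthogonal; it follows below from interpolation. *)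
pose lam j := u 0%MM 0 j * t 0%MM j 0.
have rep : represents L D (2 * w) x lam.
  apply: represents_mnm => a sa da.
  (* A monomial of degree at most [2 * w] is a product of two of degree at most [w], so its moment
     is a Gram entry. *)
  have [b [c [ea db dc]]] := mnm_split (geq_minr w (mdeg a)).
  have [sb sc] : supported D b /\ supported D c by apply: supportedDr; rewrite -ea.
  have bw : (mdeg b <= w)%N by rewrite db geq_minl.
  have cw : (mdeg c <= w)%N by rewrite dc; lia.
  have : vec b *m (vec c)^T = u b *m t c.
    by rewrite /u /t mulmxA mulmxKV.
  rewrite vecP // -ea => /(congr1 (fun M : 'M__ => M 0 0)).
  rewrite mxE eqxx mulr1n => ->; rewrite mxE; apply: eq_bigr => j _.
  by rewrite uE // tE // ea mpowD /lam; ring.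
exists x, lam; split=> // [j|j k kD].
  have ww : (w + w + 0 <= 2 * w)%N by rewrite addn0 addnn mul2n.
  have psd1 : psdmx (localize L 1 D w) by rewrite -hankelE.
  have := localize_ge0 ww rep erefl (deg_on1 R D 0) psd1 j.
  by rewrite meval1 mulr1.
have := dP k; rewrite X0 // mulmx0 => /(congr1 (mulmx^~ (invmx P))).
rewrite mulmxK // mul0mx => /(congr1 (fun M : 'M__ => M j j)).
by rewrite !mxE eqxx mulr1n => <-.
Qed.

End FlatExtension.

(** * Uniqueness of the representing measure under flatness *)

Section Uniqueness.
Variables (R : realType) (n : nat) (L : {scalar {mpoly R[n]}}).
Implicit Types (D : {set 'I_n}) (p q : {mpoly R[n]}).

(** Coordinates off [D] are zeroed instead of dropped, so that marginals on different sets remain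
    measures on one space. *)
Definition restr D (x : 'rV[R]_n) : 'rV[R]_n := \row_k if k \in D then x 0 k else 0.

Lemma meval_fsum (I : finType) (F : I -> {mpoly R[n]}) v :
  (\sum_i F i).@[v] = \sum_i (F i).@[v].
Proof. exact: (raddf_sum (meval v)). Qed.

Lemma meval_on D d p (x z : 'rV[R]_n) : deg_on D d p ->
  (forall k, k \in D -> x 0 k = z 0 k) -> p.@[x 0] = p.@[z 0].
Proof.
move=> /deg_onP hp e; rewrite !mevalE big_seq [RHS]big_seq.
apply: eq_bigr => a /hp /andP[sa _]; congr (_ * _).
exact: (eq_mpow sa e).
Qed.

(** The value of [L] at the square of [q] can be computed from either measure: it is 0 by the first,
    hence the second charges only zeros of [q]. *)
Lemma vanish_on_support D w (S T : finType) (z : S -> 'rV[R]_n) lam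
    (x : T -> 'rV[R]_n) mu q t :
  represents L D (2 * w) z lam -> represents L D (2 * w) x mu ->
  (forall t, 0 <= mu t) -> deg_on D w q -> (forall j, q.@[z j 0] = 0) ->
  mu t != 0 -> q.@[x t 0] = 0.
Proof.
move=> hz hx mu0 qd qz; apply: integral_sqr_eq0 => //.
have qq : deg_on D (2 * w) (q * q) by rewrite mul2n -addnn; apply: deg_onM.
rewrite -hx // hz // /integral_on big1 // => j _.
by rewrite mevalM qz mul0r mulr0.
Qed.

(** Interpolation polynomials exist in degree [w - 1], leaving room for one more variable:
    [('X_k - z_jk) * p_j] and [1 - \sum_j p_j] vanish at all [z j], hence on the support of [mu],
    which must restrict to the points [z j]. Quantifying over [h] states equality of image measures
    with different index types. *)
Lemma flat_unique D w r (z : 'I_r -> 'rV[R]_n) lam (T : finType)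
    (x : T -> 'rV[R]_n) mu :
  (0 < w)%N -> \rank (hankel L D (w - 1)) = r ->
  represents L D (2 * w) z lam -> (forall j k, k \notin D -> z j 0 k = 0) ->
  represents L D (2 * w) x mu -> (forall t, 0 <= mu t) ->
  forall h : 'rV[R]_n -> R,
    \sum_t mu t * h (restr D (x t)) = \sum_j lam j * h (z j).
Proof.
move=> w0 rk hz z0 hx mu0 h.
have w2 : (w - 1 + (w - 1) <= 2 * w)%N by lia.
have [c cE] := interpolation w2 hz rk.
have pd j : deg_on D (w - 1) (poly_of (c j)) := deg_on_poly_of _.
have van := vanish_on_support hz hx mu0.
have supp t : mu t != 0 -> exists j, restr D (x t) = z j.
  move=> mut.
  have : (1 - \sum_j poly_of (c j)).@[x t 0] = 0.
    apply: van => //.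
      apply: deg_onB; first exact: deg_on1.
      by apply: deg_on_sum => j _; apply: deg_onW (pd j); rewrite leq_subr.
    move=> k; rewrite mevalB meval1 meval_fsum (bigD1 k) //= cE eqxx big1.
      by rewrite addr0 subrr.
    by move=> j jk; rewrite cE (negbTE jk).
  rewrite mevalB meval1 meval_fsum => /eqP; rewrite subr_eq0 => e.
  have [j pj] : exists j, (poly_of (c j)).@[x t 0] != 0.
    apply/existsP; rewrite -[[exists _, _]]negbK; apply/negP => /existsPn h0.
    move: e; rewrite big1 ?oner_eq0 // => j _; apply/eqP/negPn/h0.
  exists j; apply/rowP => k; rewrite mxE; case: ifP => kD; last first.
    by rewrite z0 // kD.
  have : (('X_k - (z j 0 k)%:MP) * poly_of (c j)).@[x t 0] = 0.
    apply: van => //.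
      have w1 : (1 + (w - 1) <= w)%N by lia.
      apply: deg_onW w1 _; apply: deg_onM => //; apply: deg_onB; last exact: deg_onC.
      by apply: deg_onX; rewrite ?mdeg1 ?supportedU.
    move=> l; rewrite mevalM mevalB mevalXU mevalC cE.
    by case: eqP => [->|_]; rewrite ?subrr ?mul0r ?mulr0.
  rewrite mevalM mevalB mevalXU mevalC => /eqP.
  by rewrite mulf_eq0 (negbTE pj) orbF subr_eq0 => /eqP.
have pp j : deg_on D (2 * w) (poly_of (c j) * poly_of (c j)).
  by apply: deg_onW w2 _; apply: deg_onM.
(* On both supports the squared interpolation polynomials are indicators of the points [z j], so [L]
   determines the masses. *)
transitivity (\sum_t \sum_j h (z j) * (mu t * (poly_of (c j) * poly_of (c j)).@[x t 0])).
  apply: eq_bigr => t _; case: (eqVneq (mu t) 0) => [->|mut].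
    by rewrite mul0r big1 // => j _; rewrite mul0r mulr0.
  have [j0 ej] := supp t mut; rewrite ej.
  have ev j : (poly_of (c j)).@[x t 0] = (j == j0)%:R.
    rewrite -cE -ej; apply: meval_on (pd j) _ => k kD; by rewrite mxE kD.
  rewrite (bigD1 j0) //= big1 => [|j jj]; rewrite mevalM ev.
    by rewrite eqxx !mulr1 addr0 mulrC.
  by rewrite (negbTE jj) !mulr0.
rewrite exchange_big /=; apply: eq_bigr => j _; rewrite -mulr_sumr.
have := hx _ (pp j); rewrite /integral_on => <-.
rewrite hz // /integral_on (bigD1 j) //= big1 => [|k kj]; rewrite mevalM cE.
  by rewrite eqxx !mulr1 addr0 mulrC.
by rewrite eq_sym (negbTE kj) !mulr0.
Qed.

End Uniqueness.

(* The two measures are made conditionally independent given the common value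
   of [f1] and [f2]. *)
Lemma coupling (R : realType) (S : eqType) (T1 T2 : finType)
  (f1 : T1 -> S) (f2 : T2 -> S) (mu : T1 -> R) (nu : T2 -> R) :
  (forall t, 0 <= mu t) -> (forall t, 0 <= nu t) ->
  (forall s, \sum_(t | f1 t == s) mu t = \sum_(t | f2 t == s) nu t) ->
  exists gam : T1 * T2 -> R,
    [/\ forall t, 0 <= gam t,
        forall t1, \sum_t2 gam (t1, t2) = mu t1,
        forall t2, \sum_t1 gam (t1, t2) = nu t2 &
        forall t1 t2, gam (t1, t2) != 0 ->
          [/\ f1 t1 = f2 t2, mu t1 != 0 & nu t2 != 0]].
Proof.
move=> mu0 nu0 e.
pose c s := \sum_(t | f1 t == s) mu t.
have c0 s : 0 <= c s by apply: sumr_ge0.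
exists (fun t => if f1 t.1 == f2 t.2 then mu t.1 * nu t.2 / c (f1 t.1) else 0).
split=> [t|t1|t2|t1 t2 /=].
- by case: ifP => // _; rewrite divr_ge0 ?mulr_ge0.
- under eq_bigr do rewrite /= eq_sym.
  rewrite -big_mkcond /= -mulr_suml -mulr_sumr -e -/(c _).
  (* On a fibre of mass 0 the quotient defaults to 0, which is right since every weight in the fibre
     vanishes. *)
  case: (eqVneq (c (f1 t1)) 0) => [c00|cn0]; last by rewrite mulfK.
  rewrite c00 mulr0 mul0r; move/eqP: c00; rewrite psumr_eq0 //.
  move=> /allP/(_ t1); rewrite mem_index_enum eqxx => /(_ isT).
  by move=> /eqP.
- under eq_bigr => t1 _.
    have -> : (if f1 (t1, t2).1 == f2 (t1, t2).2
       then mu (t1, t2).1 * nu (t1, t2).2 / c (f1 (t1, t2).1) else 0) =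
     (if f1 t1 == f2 t2 then mu t1 * (nu t2 / c (f2 t2)) else 0).
      by rewrite /=; case: eqP => // ->; rewrite mulrA.
    over.
  rewrite -big_mkcond /= -mulr_suml -/(c _).
  case: (eqVneq (c (f2 t2)) 0) => [c00|cn0]; last by rewrite mulrC divfK.
  rewrite c00 mul0r; move/eqP: c00; rewrite /c e psumr_eq0 //.
  move=> /allP/(_ t2); rewrite mem_index_enum eqxx => /(_ isT).
  by move=> /eqP.
case: (f1 t1 =P f2 t2) => [ef|_]; last by rewrite eqxx.
by rewrite !mulf_eq0 !negb_or => /andP[/andP[-> ->] _].
Qed.

(** * Gluing along the cliques *)

Section Gluing.
Variables (R : realType) (n m : nat) (Dl : 'I_m -> {set 'I_n}).
Variables (L : {scalar {mpoly R[n]}}) (w : nat) (F : 'I_m -> 'rV[R]_n -> Prop).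

(** Only the marginal on [C] is asserted to be unique; the points themselves may differ in the other
    coordinates. *)
Definition determinate (C : {set 'I_n}) (d : nat) : Prop :=
  forall (T1 T2 : finType) (x1 : T1 -> 'rV[R]_n) (x2 : T2 -> 'rV[R]_n) mu1 mu2,
    (forall t, 0 <= mu1 t) -> (forall t, 0 <= mu2 t) ->
    represents L C d x1 mu1 -> represents L C d x2 mu2 ->
    forall h : 'rV[R]_n -> R,
      \sum_t mu1 t * h (restr C (x1 t)) = \sum_t mu2 t * h (restr C (x2 t)).

Lemma representsS (D D' : {set 'I_n}) d (T : finType) (x : T -> 'rV[R]_n) mu :
  D \subset D' -> represents L D' d x mu -> represents L D d x mu.
Proof. by move=> DD' h p /(deg_onS DD')/h. Qed.

Hypothesis L1 : L 1 = 1.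
Hypothesis F_local : forall k (x z : 'rV[R]_n),
  (forall l, l \in Dl k -> x 0 l = z 0 l) -> F k x -> F k z.
Hypothesis local_atoms : forall i, exists (r : nat) (a : 'I_r -> 'rV[R]_n) mu,
  [/\ (forall t, 0 <= mu t) /\ injective a,
      forall t l, l \notin Dl i -> a t 0 l = 0,
      represents L (Dl i) (2 * w) a mu &
      forall t, mu t != 0 -> F i (a t)].
Hypothesis overlap : forall i : 'I_m, (0 < i)%N -> exists j,
  rip_parent Dl i j /\ determinate (Dl i :&: Dl j) (2 * w).

Lemma sum_indicator (T : finType) (mu : T -> R) (P : pred T) :
  \sum_(t | P t) mu t = \sum_t mu t * (P t)%:R.
Proof. by rewrite big_mkcond; apply: eq_bigr => t _; case: (P t); rewrite ?mulr1 ?mulr0. Qed.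

(* Atoms of weight zero are allowed, so that the index type of a glued measure
   can be a full product; distinctness only concerns the others. *)
Lemma glue_upto (i : nat) : (i <= m)%N ->
  exists (T : finType) (x : T -> 'rV[R]_n) (lam : T -> R),
  [/\ (forall t, 0 <= lam t) /\ \sum_t lam t = 1,
      forall t l, l \notin \bigcup_(k < m | (k < i)%N) Dl k -> x t 0 l = 0,
      forall s t, lam s != 0 -> lam t != 0 -> x s = x t -> s = t,
      forall k : 'I_m, (k < i)%N -> represents L (Dl k) (2 * w) x lam &
      forall t, lam t != 0 -> forall k : 'I_m, (k < i)%N -> F k (x t)].
Proof.
elim: i => [|i IH] im.
  exists unit, (fun=> 0), (fun=> 1); split=> //.
  - by split=> [_|]; [exact: ler01 | rewrite sumr_const card_unit].
  - by move=> ? l _; rewrite mxE.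
  - by move=> [] [].
have [T2 [b [nu [[nu0 nu1] b0 binj brep bF]]]] := IH (ltnW im).
pose io := Ordinal im; set U := \bigcup_(k < m | (k < i)%N) Dl k.
rewrite -/U in b0.
have [r [a [mu [[mu0 ainj] a0 arep aF]]]] := local_atoms io.
pose C := Dl io :&: U.
have marg s : \sum_(t | restr C (a t) == s) mu t = \sum_(t | restr C (b t) == s) nu t.
  rewrite [LHS]sum_indicator [RHS]sum_indicator.
  case: (posnP i) => [i0|i_gt0].
    (* For the first clique the overlap is empty and both marginals are unit masses at 0, by
       [L1]. *)
    have rC x : restr C x = 0.
      apply/rowP => k; rewrite !mxE inE /U i0.
      by rewrite big_pred0 // inE andbF.
    under eq_bigr do rewrite rC; under [RHS]eq_bigr do rewrite rC.
    rewrite -!mulr_suml nu1; congr (_ * _).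
    by rewrite -L1 (arep _ (deg_on1 _ _ _)); apply: eq_bigr => t _; rewrite meval1 mulr1.
  have [j [/andP[ji /fintype.subsetP capj] det]] := @overlap io i_gt0.
  (* Running intersection reduces the overlap with all earlier cliques to that with a single one,
     where determinacy is assumed. *)
  have eC : C = Dl io :&: Dl j.
    apply/setP => k; apply/idP/idP => [kC|].
      by rewrite inE (capj _ kC) andbT; move: kC; rewrite inE => /andP[].
    rewrite !inE => /andP[-> kj] /=; apply/finset.bigcupP; by exists j.
  rewrite eC; apply: (det _ _ _ _ _ _ mu0 nu0 _ _ (fun z => (z == s)%:R)).
    by apply: representsS arep; rewrite subsetIl.
  by apply: representsS (brep j ji); rewrite subsetIr.
have [gam [g0 g1 g2 gn0]] := coupling mu0 nu0 marg.
(* Clique coordinates come from [a], all others from [b]; where [gam] is nonzero the two agree on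
   the overlap. *)
pose x (t : 'I_r * T2) : 'rV[R]_n := \row_k if k \in Dl io then a t.1 0 k else b t.2 0 k.
have xa t k : k \in Dl io -> x t 0 k = a t.1 0 k by move=> kD; rewrite mxE kD.
have xb t k : gam t != 0 -> k \in U -> x t 0 k = b t.2 0 k.
  case: t => t1 t2 /gn0[e _ _] kU; rewrite mxE; case: ifP => // kD.
  by have := congr1 (fun v : 'rV__ => v 0 k) e; rewrite !mxE inE kD kU.
have DU (k : 'I_m) l : (k < i)%N -> l \in Dl k -> l \in U.
  by move=> ki lk; apply/finset.bigcupP; exists k.
exists ('I_r * T2)%type, x, gam; split.
- split=> //; rewrite -nu1 -(eq_bigr _ (fun t _ => g2 t)) exchange_big.
  by rewrite pair_big; apply: eq_bigr => -[].
- move=> t l lU; rewrite mxE; have lD : l \notin Dl io.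
    by apply: contra lU => lD; apply/finset.bigcupP; exists io => //=.
  rewrite (negbTE lD) b0 //; apply: contra lU => /finset.bigcupP[k ki lk].
  by apply/finset.bigcupP; exists k => //; apply: ltnW.
- move=> [s1 s2] [t1 t2] gs gt e.
  have [_ _ ns] := gn0 _ _ gs; have [_ _ nt] := gn0 _ _ gt.
  (* Both partial points vanish off their own coordinates, so equality of glued points passes to
     each factor. *)
  congr pair.
    apply: ainj; apply/rowP => k; case: (boolP (k \in Dl io)) => kD; last by rewrite !a0.
    by rewrite -(xa (s1, s2)) // e xa.
  apply: binj => //; apply/rowP => k; case: (boolP (k \in U)) => kU; last by rewrite !b0.
  by rewrite -(xb (s1, s2)) // e xb.
- move=> k; rewrite ltnS leq_eqVlt => /orP[/eqP ki|ki] p pd.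
    have ek : k = io by apply: val_inj.
    rewrite ek in pd *; rewrite arep // /integral_on.
    under eq_bigr do rewrite -g1 mulr_suml.
    rewrite pair_big; apply: eq_bigr => -[t1 t2] _ /=; congr (_ * _).
    by apply: meval_on pd _ => l lD; rewrite xa.
  rewrite (brep k ki) // /integral_on.
  under eq_bigr do rewrite -g2 mulr_suml.
  rewrite exchange_big pair_big; apply: eq_bigr => -[t1 t2] _ /=.
  case: (eqVneq (gam (t1, t2)) 0) => [->|gt]; first by rewrite !mul0r.
  congr (_ * _); apply: meval_on pd _ => l lD.
  by rewrite xb //; apply: DU lD.
move=> [t1 t2] gt k; have [_ mt nt] := gn0 _ _ gt.
rewrite ltnS leq_eqVlt => /orP[/eqP ki|ki].
  have -> : k = io by apply: val_inj.
  by apply: F_local (aF _ mt) => l lD; rewrite xa.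
apply: F_local (bF _ nt k ki) => l lD; rewrite xb //; exact: DU lD.
Qed.

(** The atoms of weight zero are discarded from the measure glued over all cliques. *)
Lemma glue_cliques :
  exists (r : nat) (x : 'I_r -> 'rV[R]_n) (lam : 'I_r -> R),
  [/\ (forall t, 0 < lam t) /\ \sum_t lam t = 1, injective x,
      forall k, represents L (Dl k) (2 * w) x lam &
      forall t k, F k (x t)].
Proof.
have [T [x [lam [[lam0 lam1] _ xinj rep xF]]]] := glue_upto (leqnn m).
pose A := [pred t | lam t != 0].
have restrict h : \sum_t lam t * h t = \sum_(j < #|A|) lam (enum_val j) * h (enum_val j).
  transitivity (\sum_(t in A) lam t * h t); last by rewrite big_enum_val.
  rewrite [RHS]big_mkcond.
  by apply: eq_bigr => t _; rewrite inE; case: eqP => //= ->; rewrite mul0r.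
exists #|A|, (fun j => x (enum_val j)), (fun j => lam (enum_val j)).
have lamA (j : 'I_#|A|) : lam (enum_val j) != 0 := enum_valP j.
split=> [|j k e|k p pd|j k].
- split=> [j|]; first by rewrite lt_neqAle eq_sym lamA lam0.
  have := restrict (fun=> 1); under eq_bigr do rewrite mulr1.
  by rewrite lam1 => ->; apply: eq_bigr => j _; rewrite mulr1.
- by apply: enum_val_inj; apply: xinj.
- by rewrite (rep k (ltn_ord k) p pd) /integral_on restrict.
exact: xF.
Qed.

End Gluing.

(** * The sparse moment relaxation *)

Section PositiveSemidefinite.
Variable R : realType.

Lemma psd_congruence k l (M : 'M[R]_k) (S : 'M_(l, k)) :
  psdmx M -> psdmx (S *m M *m S^T).
Proof.
move=> [sM pM]; split; first by rewrite !trmx_mul sM trmxK mulmxA.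
by move=> v; have := pM (v *m S); rewrite trmx_mul !mulmxA.
Qed.

Lemma psd_mxdiag p (p_ : 'I_p -> nat) (B_ : forall i, 'M[R]_(p_ i)) :
  psdmx (\mxdiag_i B_ i) <-> forall i, psdmx (B_ i).
Proof.
split=> [psd i|psd].
  pose S := submxcol (1%:M : 'M[R]_(\sum_i p_ i)) i.
  have := psd_congruence S psd; rewrite submxcol_mul mul1mx.
  rewrite /S tr_submxcol trmx1 mul_submxrow mulmx1.
  by rewrite -submxblockEv submxblock_diag.
split; first by rewrite tr_mxdiag; apply/eq_mxdiag => i; have [-> _] := psd i.
move=> v; rewrite -[v]submxrowK mul_mxrow_mxdiag tr_mxrow mul_mxrow_mxcol.
by rewrite summxE sumr_ge0 // => i _; have [_] := psd i; apply.
Qed.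

End PositiveSemidefinite.

(** * Moment matrices under restriction of variables and degree *)

Section Moments.
Variables (R : realType) (n : nat) (L : {scalar {mpoly R[n]}}).
Implicit Types (C D : {set 'I_n}) (p q : {mpoly R[n]}).

(** A principal submatrix written as a congruence, so that rank bounds and positivity both carry
    over. *)
Lemma hankel_submx C D d d' : C \subset D -> (d' <= d)%N ->
  exists S, hankel L C d' = S *m hankel L D d *m S^T.
Proof.
move=> CD dd.
have ex (i : 'I_#|loc_index C d'|) : exists j : 'I_#|loc_index D d|, loc_mnm j = loc_mnm i.
  apply: loc_mnm_ex; first exact: supportedS CD (loc_mnm_supp i).
  exact: leq_trans (loc_mnm_deg i) dd.
have [phi phiE] := fin_all_exists ex.
exists (rowsub phi 1%:M).
rewrite trmx_mxsub trmx1 mul_rowsub_mx mul1mx mulmx_colsub mulmx1.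
by apply/matrixP => i j; rewrite !mxE !loc_monomE !phiE.
Qed.

Lemma rank_hankel_mono D d d' : (d' <= d)%N ->
  (\rank (hankel L D d') <= \rank (hankel L D d))%N.
Proof.
move=> dd; have [S ->] := hankel_submx (subxx D) dd.
exact: leq_trans (mxrankM_maxl _ _) (mxrankM_maxr _ _).
Qed.

Lemma psd_hankelS C D d : C \subset D ->
  psdmx (hankel L D d) -> psdmx (hankel L C d).
Proof.
by move=> CD psd; have [S ->] := hankel_submx CD (leqnn d); apply: psd_congruence.
Qed.

Lemma psd_localize D d e e' (T : finType) (x : T -> 'rV[R]_n) lam q :
  represents L D e x lam -> (d + d + e' <= e)%N -> deg_on D e' q ->
  (forall t, 0 <= lam t * q.@[x t 0]) -> psdmx (localize L q D d).
Proof.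
move=> rep de qd q0; split; first by apply/matrixP => i j; rewrite !mxE mulrAC.
move=> v; rewrite localizeE rep; last first.
  apply: deg_onW de _; rewrite addnC addnA.
  by do 2?apply: deg_onM => //; exact: deg_on_poly_of.
apply: sumr_ge0 => t _; rewrite !mevalM; set s := (poly_of v).@[_].
have -> : lam t * (q.@[x t 0] * s * s) = lam t * q.@[x t 0] * s ^+ 2 by ring.
by rewrite mulr_ge0 ?q0 ?sqr_ge0.
Qed.

Lemma flat_determinate C w : (0 < w)%N -> psdmx (hankel L C w) ->
  \rank (hankel L C w) = \rank (hankel L C (w - 1)) -> determinate L C (2 * w).
Proof.
move=> w0 psd rk; have [z [lam [lam0 rep z0]]] := flat_extension w0 psd rk.
move=> T1 T2 x1 x2 mu1 mu2 p1 p2 r1 r2 h.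
rewrite (flat_unique w0 (esym rk) rep z0 r1 p1).
by rewrite (flat_unique w0 (esym rk) rep z0 r2 p2).
Qed.

End Moments.

Lemma deg_on_lift_poly (R : realType) n (D : {set 'I_n}) (p : {mpoly R[#|D|]}) :
  deg_on D (mdegp p) (lift_poly p).
Proof.
rewrite /lift_poly comp_mpolyE big_seq; apply: deg_on_sum => a ap.
apply: deg_onZ; have ad : (mdeg a <= mdegp p)%N.
  by rewrite /mdegp -ltnS; apply: leq_trans (msize_mdeg_lt ap) (leqSpred _).
apply: deg_onW ad _.
under eq_bigr do rewrite tnth_mktuple mpolyXn.
rewrite -(big_morph (fun b => 'X_[b]) (@mpolyXD n R) (@mpolyX0 n R)).
apply: deg_onX.
  apply: (big_ind (supported D)) => [||i _]; [exact: supported0|exact: supportedD|].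
  apply/supportedP => k kD; rewrite mulmnE mnm1E.
  by case: eqP => // ek; rewrite -ek enum_valP in kD.
by rewrite mdeg_sum mdegE leq_sum // => i _; rewrite mdegMn mdeg1 mul1n.
Qed.

(** * Dirac measures and local atoms for the relaxation *)

Section Relaxation.
Variables (R : realType) (n m : nat) (Dl : 'I_m -> {set 'I_n}) (w : nat).
Implicit Type y : {ffun cs_index Dl w -> R}.

Lemma riesz_is_scalar y : scalar (riesz y).
Proof.
move=> c p q; rewrite /riesz mulr_sumr -big_split; apply: eq_bigr => a _ /=.
by rewrite mcoeffD mcoeffZ mulrDl mulrA.
Qed.

HB.instance Definition _ y :=
  GRing.isLinear.Build R {mpoly R[n]} R *%R (riesz y) (riesz_is_scalar y).

Lemma moment_mxE y D d : moment_mx y D d = hankel (riesz y) D d.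
Proof. by []. Qed.

Lemma localizing_mxE y q D d : localizing_mx y q D d = localize (riesz y) q D d.
Proof. by []. Qed.

Definition sparse p :=
  all (fun a => [exists i, supported (Dl i) a] && (mdeg a <= 2 * w)%N) (@msupp n R p).

(** Every monomial of a sparse polynomial lies in some clique, so the representations on single
    cliques add up. *)
Lemma riesz_sparse y (T : finType) (x : T -> 'rV[R]_n) lam p :
  (forall i, represents (riesz y) (Dl i) (2 * w) x lam) -> sparse p ->
  riesz y p = integral_on x lam p.
Proof.
move=> rep /allP hp; rewrite {1}[p]mpolyE linear_sum /=.
transitivity (\sum_(a <- msupp p) \sum_t lam t * (p@_a * mpow (x t) a)).
  rewrite big_seq [RHS]big_seq; apply: eq_bigr => a /hp /andP[/existsP[i sa] da].
  rewrite linearZ /= (rep i) ?deg_onX // mulr_sumr.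
  by apply: eq_bigr => t _; rewrite mpowE mulrCA.
by rewrite exchange_big; apply: eq_bigr => t _ /=; rewrite mevalE -mulr_sumr.
Qed.

Definition dirac_moments (z : 'rV[R]_n) : {ffun cs_index Dl w -> R} :=
  [ffun a => mpow z (cs_mnm a)].

Lemma represents_dirac z i :
  represents (riesz (dirac_moments z)) (Dl i) (2 * w) (fun _ : unit => z) (fun=> 1).
Proof.
apply: represents_mnm => a sa da.
have [b <-] : exists b : cs_index Dl w, cs_mnm b = a.
  by apply/cs_mnmP; exists i; split=> //; apply/supportedP.
by rewrite /= rieszX ffunE big_const card_unit /= mul1r addr0.
Qed.

Variables (f : forall i, {mpoly R[#|Dl i|]}) (N : 'I_m -> nat).
Variable g : forall i, 'I_(N i) -> {mpoly R[#|Dl i|]}.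
Hypothesis degg : forall i, (deg_constr g i <= 2 * w)%N.
Hypothesis w_gt0 : (0 < w)%N.

Lemma half_deg_gt0 i : (0 < half_deg g i)%N.
Proof. by rewrite leq_max. Qed.

Lemma half_deg_le i : (half_deg g i <= w)%N.
Proof. by rewrite geq_max w_gt0; have := degg i; lia. Qed.

(** The order [w - half_deg g i] keeps a constraint times two test polynomials within degree
    [2 * w]; the subtraction is not truncated, by [half_deg_le]. *)
Lemma constr_deg i (k : 'I_(N i)) : (w - half_deg g i + (w - half_deg g i) + mdegp (g k) <= 2 * w)%N.
Proof.
have h : (mdegp (g k) <= deg_constr g i)%N.
  exact: (@leq_bigmax _ (fun k => mdegp (@g i k))).
have := half_deg_le i; have : (uphalf (deg_constr g i) <= half_deg g i)%N.
  by rewrite leq_max leqnn orbT.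
lia.
Qed.

Lemma dirac_feasible z : pop_feasible g z -> relax_feasible g (dirac_moments z).
Proof.
move=> zf; split=> [i|i|a a0].
- have ww : (w + w + 0 <= 2 * w)%N by rewrite addn0 addnn mul2n.
  have z1 (t : unit) : 0 <= 1 * (1 : {mpoly R[n]}).@[z 0] by rewrite meval1 mulr1.
  rewrite moment_mxE hankelE.
  exact: (psd_localize (@represents_dirac z i) ww (deg_on1 R _ _) z1).
- apply/psd_mxdiag => k; rewrite localizing_mxE.
  have zk (t : unit) : 0 <= 1 * (lift_poly (g k)).@[z 0].
    by rewrite mul1r meval_lift_poly.
  exact: (psd_localize (@represents_dirac z i) (constr_deg k) (deg_on_lift_poly _) zk).
by rewrite ffunE a0 mpowE mpolyX0 meval1.
Qed.

Lemma sparse_objective : (mdegp (objective f) <= 2 * w)%N -> sparse (objective f).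
Proof.
move=> degf; apply/allP => a ha; apply/andP; split; last first.
  apply: leq_trans degf; rewrite /mdegp -ltnS.
  exact: leq_trans (msize_mdeg_lt ha) (leqSpred _).
have := msupp_sum_le ha; case/flatten_mapP => i _ /(deg_onP _ _ _ (deg_on_lift_poly _)).
by case/andP => sa _; apply/existsP; exists i.
Qed.

Lemma riesz_dirac z : sparse (objective f) ->
  riesz (dirac_moments z) (objective f) = (objective f).@[z 0].
Proof.
move=> /(riesz_sparse (@represents_dirac z)) ->.
by rewrite /integral_on big_const card_unit /= mul1r addr0.
Qed.

Lemma local_atoms_of_flat y i : relax_feasible g y ->
  \rank (moment_mx y (Dl i) w) = \rank (moment_mx y (Dl i) (w - half_deg g i)) ->
  exists (r : nat) (a : 'I_r -> 'rV[R]_n) mu,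
  [/\ (forall t, 0 <= mu t) /\ injective a,
      forall t l, l \notin Dl i -> a t 0 l = 0,
      represents (riesz y) (Dl i) (2 * w) a mu &
      forall t, mu t != 0 -> forall k, 0 <= (@g i k).@[subvec (Dl i) (a t) 0]].
Proof.
move=> [psd psdg _] rk; have := psd i; rewrite !moment_mxE in rk * => psdi.
have le1 : (w - half_deg g i <= w - 1)%N by rewrite leq_sub2l ?half_deg_gt0.
(* As [half_deg g i >= 1], the rank at order [w - 1] is squeezed between two equal ranks. *)
have rk1 : \rank (hankel (riesz y) (Dl i) w) = \rank (hankel (riesz y) (Dl i) (w - 1)).
  apply/eqP; rewrite eqn_leq [in X in X && _]rk !rank_hankel_mono //.
  by rewrite leq_subr.
have [x [lam [lam0 rep x0]]] := flat_extension w_gt0 psdi rk1.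
have w2 : (w + w <= 2 * w)%N by rewrite addnn mul2n.
exists (\rank (hankel (riesz y) (Dl i) w)), x, lam; split=> //.
  by split=> //; have [c /interpolation_inj] := interpolation w2 rep erefl.
move=> t lamt k; rewrite -meval_lift_poly.
have := psdg i; rewrite /block_localizing_mx => /psd_mxdiag/(_ k) psdk.
(* By [rk] the rank at order [w - half_deg g i] already counts the atoms, so interpolation works in
   the degree that the localizing matrix tests. *)
have := localize_ge0 (constr_deg k) rep (esym rk) (deg_on_lift_poly _) psdk t.
by rewrite pmulr_rge0 // lt_neqAle eq_sym lamt lam0.
Qed.

End Relaxation.

(** * Optimal values and extraction of the minimizers *)

Lemma ereal_inf_attained (R : realType) (S : set \bar R) v :
  S v -> (forall u, S u -> (v <= u)%E) -> ereal_inf S = v.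
Proof.
move=> Sv lb; apply/eqP; rewrite eq_le; apply/andP; split.
  exact: ereal_inf_lbound.
exact: le_ereal_inf_tmp.
Qed.

Unset Implicit Arguments.

Theorem corollary1p2 (R : realType) (n m : nat)
  (n_gt0 : (0 < n)%N) (m_gt0 : (0 < m)%N)
  (Dl : 'I_m -> {set 'I_n})
  (Dl_cover : \bigcup_(i < m) Dl i = [set: 'I_n])
  (Dl_antichain : forall i j : 'I_m, i != j -> ~~ (Dl i \subset Dl j))
  (f : forall i : 'I_m, {mpoly R[#|Dl i|]})
  (N : 'I_m -> nat)
  (g : forall i : 'I_m, 'I_(N i) -> {mpoly R[#|Dl i|]})
  (w : nat)
  (w_ge1 : (1 <= 2 * w)%N)
  (w_degf : (mdegp (objective f) <= 2 * w)%N)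
  (w_degg : forall i : 'I_m, (deg_constr g i <= 2 * w)%N)
  (rip : forall i : 'I_m, (0 < i)%N -> exists j : 'I_m, rip_parent Dl i j)
  (y : {ffun cs_index Dl w -> R})
  (y_opt : relax_minimizer f g y)
  (y_rank : forall i : 'I_m,
     \rank (moment_mx y (Dl i) w) =
     \rank (moment_mx y (Dl i) (w - half_deg g i)))
  (y_rank_cap : forall i : 'I_m, (0 < i)%N -> exists j : 'I_m,
     rip_parent Dl i j /\
     \rank (moment_mx y (Dl i :&: Dl j) w) =
     \rank (moment_mx y (Dl i :&: Dl j) (w - 1))) :
  relax_value w f g = pop_value f g /\
  exists (r : nat) (x : 'I_r -> 'rV[R]_n) (lam : 'I_r -> R),
    (\max_(i < m) \rank (moment_mx y (Dl i) w) <= r)%N /\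
    injective x /\
    (forall k : 'I_r, pop_feasible g (x k)) /\
    (forall k : 'I_r, 0 < lam k) /\
    (forall a : cs_index Dl w, y a = \sum_(k < r) lam k * mpow (x k) (cs_mnm a)) /\
    (forall k : 'I_r, pop_minimizer f g (x k)).
Proof.
have w0 : (0 < w)%N by move: w_ge1; case: (w).
have [[psd psdg y0] ymin] := y_opt; have yfeas := y_opt.1.
have [a0 a0E] : exists a : cs_index Dl w, cs_mnm a = 0%MM.
  by apply/cs_mnmP; exists (Ordinal m_gt0); split=> [k _|]; rewrite ?mnm0E ?mdeg0.
have L1 : riesz y 1 = 1 by rewrite -mpolyX0 -a0E rieszX y0.
pose F i (x : 'rV[R]_n) := forall k, 0 <= (g i k).@[subvec (Dl i) x 0].
have F_local k (x z : 'rV_n) : (forall l, l \in Dl k -> x 0 l = z 0 l) ->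
    F k x -> F k z.
  move=> e Fx l; have -> // : subvec (Dl k) z = subvec (Dl k) x.
  by apply/rowP => j; rewrite !mxE e // enum_valP.
have atoms i := local_atoms_of_flat w_degg w0 yfeas (y_rank i).
have overlap (i : 'I_m) : (0 < i)%N -> exists j,
    rip_parent Dl i j /\ determinate (riesz y) (Dl i :&: Dl j) (2 * w).
  move=> /y_rank_cap[j [ij rk]]; exists j; split=> //.
  by apply: flat_determinate => //; apply: psd_hankelS (psd i); rewrite subsetIl.
have [r [x [lam [[lam0 lam1] xinj rep xF]]]] :=
  glue_cliques L1 F_local atoms overlap.
have xfeas k : pop_feasible g (x k) by move=> i; apply: xF.
have spf := sparse_objective w_degf.
set v := riesz y (objective f) in ymin.
have vle z : pop_feasible g z -> v <= (objective f).@[z 0].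
  by move=> zf; rewrite -(riesz_dirac z spf); apply/ymin/dirac_feasible.
(* The gaps to [v] are nonnegative and average to 0 under positive weights, so each of them is 0. *)
have vE k : (objective f).@[x k 0] = v.
  have : \sum_k lam k * ((objective f).@[x k 0] - v) = 0.
    under eq_bigr do rewrite mulrBr.
    by rewrite sumrB -mulr_suml lam1 mul1r [v](riesz_sparse rep spf) subrr.
  move/eqP; rewrite psumr_eq0 => [/allP/(_ k)|j _]; last first.
    by rewrite mulr_ge0 ?(ltW (lam0 _)) // subr_ge0 vle.
  rewrite mem_index_enum mulf_eq0 gt_eqF //= => /(_ isT).
  by rewrite subr_eq0 => /eqP.
(* Weights of total mass 1 require an atom, which then attains the infimum of the polynomial
   problem. *)
have r0 : (0 < r)%N.
  case: (r) lam lam1 {lam0 xinj rep xF xfeas vE x} => // lam.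
  by rewrite big_ord0 => /eqP; rewrite eq_sym oner_eq0.
split.
  rewrite /relax_value /pop_value (@ereal_inf_attained _ _ v%:E); last first.
  - by move=> _ [z zf <-]; rewrite lee_fin; apply: ymin.
  - by exists y.
  rewrite (@ereal_inf_attained _ _ v%:E) //.
  - by exists (x (Ordinal r0)) => //; rewrite vE.
  - by move=> _ [z zf <-]; rewrite lee_fin; apply: vle.
exists r, x, lam; split; last split=> //; last split=> //; last split=> //; last split.
- apply/bigmax_leqP => i _; apply: rank_hankel_le (rep i).
  by rewrite addnn mul2n.
- move=> a; have [i [ha da]] : exists i, (forall k, k \notin Dl i -> cs_mnm a k = 0%N) /\
      (mdeg (cs_mnm a) <= 2 * w)%N by apply/cs_mnmP; exists a.
  rewrite -rieszX (rep i); last by apply: deg_onX => //; apply/supportedP.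
  by apply: eq_bigr => k _; rewrite mpowE.
by move=> k; split=> // z zf; rewrite vE vle.
Qed.
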